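(* Let $n$ and $k$ be fixed positive integers with $k<n$. Set $s=\lfloor (n-1)/k\rfloor$, and define $r$ by $n=sk+r$ with $1\leq r\leq k$. Define $d_s=\gcd(n,s)$ and $d_k=\gcd(n,k)$. Assume that $r<k$ and $r<s$, and that $d_sd_k$ divides $n$. Then there is a bijection between the set of clockwise $(s,k)$-clash-free permutations $\pi$ of $\mathbb{Z}_n$ with $\pi(0)=0$ and the set $J(s,k,n)$ of $(s,k,n)$-jumpers.
   Context: For $i,j\in\mathbb{Z}_n$ define $||i,j||_n=\min\{(i-j)\bmod n,(j-i)\bmod n\}$. A permutation $\pi:\mathbb{Z}_n\to\mathbb{Z}_n$ is $(s,k)$-clash-free if $||\pi(i),\pi(j)||_n\geq k$ for all distinct $i,j\in\mathbb{Z}_n$ with $||i,j||_n<s$. Rectangles. Given an $(s,k)$-clash-free permutation $\pi$, for $i\in\mathbb{Z}_n$ let $R_i=\{(i+x,\pi(i)+y):0\leq x<s,\ 0\leq y<k\}\subseteq\mathbb{Z}_n^2$ (first coordinate horizontal, increasing to the right; second coordinate vertical, increasing upwards). These rectangles are pairwise disjoint. A rectangle $R_j$ touches the top edge of $R_i$ if $R_j$ contains one of the $s$ cells $(i+x,\pi(i)+k)$, $0\leq x<s$, immediately above $R_i$; touching the bottom, left and right edges is defined analogously using the cells immediately below, to the left of, and to the right of $R_i$. When $n,s,k,r$ satisfy the hypotheses $r<s$, $r<k$, exactly one rectangle touches each of the four edges of each rectangle. Clockwise. A rectangle $R_i$ is clockwise if: the rectangle touching its top edge is displaced to the right, i.e.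 it is $R_j$ with $j=i+a$, $\pi(j)=\pi(i)+k$ for some $1\leq a<s$; the rectangle touching its right edge is displaced downwards, i.e. it is $R_j$ with $j=i+s$, $\pi(j)=\pi(i)-b$ for some $1\leq b<k$; the rectangle touching its bottom edge is displaced to the left, i.e. it is $R_j$ with $j=i-a'$, $\pi(j)=\pi(i)-k$ for some $1\leq a'<s$; and the rectangle touching its left edge is displaced upwards, i.e. it is $R_j$ with $j=i-s$, $\pi(j)=\pi(i)+b'$ for some $1\leq b'<k$. The permutation $\pi$ is clockwise if all its rectangles $R_i$ are clockwise. Jumpers. An $(s,k,n)$-jumper is a pair $\big((a_i)_{i\geq 0},(b_i)_{i\geq 0}\big)$ of sequences of integers such that: (1) $(a_i)$ has period dividing $d_s$ (so $a_{i+d_s}=a_i$ for all $i$) and $(b_i)$ has period dividing $d_k$; (2) $1\leq a_i<s$ and $1\leq b_i<k$ for all $i\geq 0$; (3) the $d_k$ partial sums $\sum_{i=0}^{\ell-1}b_i$, $0\leq\ell<d_k$, are distinct modulo $d_k$, and $d_sd_k$ divides $\sigma_b:=\sum_{i=0}^{d_k-1}b_i$; (4) the $d_s$ partial sums $\sum_{i=0}^{m-1}a_i$, $0\leq m<d_s$, are distinct modulo $d_s$, and $d_sd_k$ divides $\sigma_a:=\sum_{i=0}^{d_s-1}a_i$; (5) $\sigma_a\sigma_b=d_sd_kr$. $J(s,k,n)$ denotes the set of all $(s,k,n)$-jumpers. *)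

(* Defs.v *)
From mathcomp Require Import all_boot all_order all_algebra all_fingroup.
From mathcomp Require Import classical_sets functions.

Set Implicit Arguments.
Unset Strict Implicit.
Unset Printing Implicit Defensive.

Import Order.TTheory GRing.Theory Num.Theory.
Local Open Scope ring_scope.

(* Throughout, ['Z_n] is the ring of integers modulo [n] only for [1 < n];
   its elements coerce to their representative in [0, n). *)

Definition cdist (n : nat) (i j : 'Z_n) : nat := minn (i - j)%R (j - i)%R.

Definition clash_free (n s k : nat) (pi : {perm 'Z_n}) : Prop :=
  forall i j : 'Z_n,
    i != j -> (cdist i j < s)%N -> (k <= cdist (pi i) (pi j))%N.

Section Rectangles.
Variables (n s k : nat) (pi : {perm 'Z_n}).
Implicit Types i j : 'Z_n.

Definition rect i : {set 'Z_n * 'Z_n} :=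
  [set (i + x%:R, pi i + y%:R) | x : 'I_s, y : 'I_k].

Definition cells_above i : {set 'Z_n * 'Z_n} :=
  [set (i + x%:R, pi i + k%:R) | x : 'I_s].
Definition cells_right i : {set 'Z_n * 'Z_n} :=
  [set (i + s%:R, pi i + y%:R) | y : 'I_k].
Definition cells_below i : {set 'Z_n * 'Z_n} :=
  [set (i + x%:R, pi i - 1) | x : 'I_s].
Definition cells_left i : {set 'Z_n * 'Z_n} :=
  [set (i - 1, pi i + y%:R) | y : 'I_k].

(* [rect j] is the rectangle, i.e. the one and only rectangle, that meets the
   set of cells [E] adjacent to an edge. *)
Definition the_rect_touching (E : {set 'Z_n * 'Z_n}) j : Prop :=
  forall j' : 'Z_n, ~~ [disjoint rect j' & E] <-> j' = j.

Definition clockwise_rect i : Prop :=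
  [/\ exists2 j, the_rect_touching (cells_above i) j
        & exists2 a : nat, (1 <= a < s)%N
            & j = i + a%:R /\ pi j = pi i + k%:R,
      exists2 j, the_rect_touching (cells_right i) j
        & exists2 b : nat, (1 <= b < k)%N
            & j = i + s%:R /\ pi j = pi i - b%:R,
      exists2 j, the_rect_touching (cells_below i) j
        & exists2 a' : nat, (1 <= a' < s)%N
            & j = i - a'%:R /\ pi j = pi i - k%:R
    & exists2 j, the_rect_touching (cells_left i) j
        & exists2 b' : nat, (1 <= b' < k)%N
            & j = i - s%:R /\ pi j = pi i + b'%:R].

Definition clockwise : Prop := forall i, clockwise_rect i.

End Rectangles.

Definition clockwise_perms (n s k : nat) : set {perm 'Z_n} :=
  [set pi | [/\ clash_free s k pi, clockwise s k pi & pi 0 = 0]]%classic.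
Arguments clockwise_perms : clear implicits.

Definition psum (u : nat -> int) (m : nat) : int := \sum_(0 <= i < m) u i.

Record is_jumper (s k n : nat) (a b : nat -> int) : Prop := IsJumper {
  jumper_period_a : forall i, a (i + gcdn n s)%N = a i;
  jumper_period_b : forall i, b (i + gcdn n k)%N = b i;
  jumper_range_a : forall i, 1 <= a i < s%:Z;
  jumper_range_b : forall i, 1 <= b i < k%:Z;
  jumper_distinct_b : forall l l' : nat,
    (l < gcdn n k)%N -> (l' < gcdn n k)%N ->
    (psum b l = psum b l' %[mod gcdn n k])%Z -> l = l';
  jumper_dvd_b : ((gcdn n s * gcdn n k)%N %| psum b (gcdn n k))%Z;
  jumper_distinct_a : forall m m' : nat,
    (m < gcdn n s)%N -> (m' < gcdn n s)%N ->
    (psum a m = psum a m' %[mod gcdn n s])%Z -> m = m';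
  jumper_dvd_a : ((gcdn n s * gcdn n k)%N %| psum a (gcdn n s))%Z;
  (* the last factor is the remainder [r] in [n = s * k + r] *)
  jumper_prod : psum a (gcdn n s) * psum b (gcdn n k)
    = (gcdn n s * gcdn n k)%N%:Z * (n%:Z - (s * k)%N%:Z)
}.

Definition jumpers (s k n : nat) : set ((nat -> int) * (nat -> int)) :=
  [set ab | is_jumper s k n ab.1 ab.2]%classic.

(* Main.v *)
Require Import Defs.
From mathcomp Require Import all_boot all_order all_algebra all_fingroup.
From mathcomp Require Import zify ring.
From mathcomp Require Import boolp classical_sets functions.

(* Write A i for the horizontal displacement of the rectangle above R_i and B i
   for the vertical drop to the rectangle on its right.  Going up then right,
   or right then up, from R_i leads to two points that are too close to be
   distinct, so A (i + s) = A i and B (i + A i) = B i.  Hence, with a and b the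
   displacements read along the two staircases from the origin,
     pi (l s + a_0 + ... + a_(m-1)) = m k - (b_0 + ... + b_(l-1)),
   and these points exhaust the graph of pi: a further rectangle would have to
   fit in a hole of size a_m x b_l.  So pi and (a, b) determine each other, and
   the jumper conditions express that the displayed formula is consistent
   modulo n.  For a jumper, the points of Z^2 given by the formula (not reduced
   modulo n) are invariant under translation by n Z^2, which reduces
   clash-freeness to the monotonicity of partial sums. *)

Section Auxiliary.
Set Implicit Arguments.
Unset Strict Implicit.
Unset Printing Implicit Defensive.
Import Order.TTheory GRing.Theory Num.Theory.
Local Open Scope ring_scope.

(** * Cyclic sequences and residues *)

(** By pigeonhole two terms agree, and cancelling the common shift gives a return to [x 0] after p
    steps with 0 < p <= [#|T|]. A return time p makes [x] depend only on the index modulo p, so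
    surjectivity forces [#|T| <= p]. *)
Lemma cyclic_sequence (T : finType) (x : nat -> T) :
  (forall m m', x m = x m' <-> x m.+1 = x m'.+1) ->
  (forall c, exists m, x m = c) ->
  forall m m', x m = x m' <-> m = m' %[mod #|T|].
Proof.
move=> xS xsurj.
have xD t m m' : x m = x m' <-> x (m + t)%N = x (m' + t)%N.
  by elim: t => [|t IHt]; rewrite ?addn0 // !addnS -xS.
have x_mod p m : x p = x 0%N -> x m = x (m %% p)%N.
  move=> xp; rewrite {1}(divn_eq m p).
  elim: (m %/ p)%N => [//|q <-]; rewrite mulSn -addnA.
  by have /(xD (q * p + m %% p)%N) := xp; rewrite add0n.
have card_le p : (0 < p)%N -> x p = x 0%N -> (#|T| <= p)%N.
  move=> p_gt0 xp; rewrite -[leqRHS]card_ord.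
  apply: leq_trans (leq_image_card (fun i : 'I_p => x i) predT).
  apply/subset_leq_card/fintype.subsetP => c _; have [m <-] := xsurj c.
  by rewrite (x_mod p m xp) (fintype.image_f (fun i : 'I_p => x i) (x := Ordinal (ltn_pmod m p_gt0))).
have [p [p_gt0 p_le xp]] : exists p, [/\ (0 < p)%N, (p <= #|T|)%N & x p = x 0%N].
  have /injectivePn[i [j neq_ij xij]] :
      ~~ injectiveb (fun i : 'I_#|T|.+1 => x i).
    by apply/injectiveP => /leq_card; rewrite card_ord ltnn.
  wlog lt_ij : i j neq_ij xij / (i < j)%N.
    move=> IH; case: (ltngtP i j) => [|ltji|/val_inj/eqP]; first exact: IH.
      by apply: (IH j i) => //; rewrite eq_sym.
    by rewrite (negPf neq_ij).
  exists (j - i)%N; split; first by rewrite subn_gt0.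
    by have := ltn_ord j; lia.
  by apply/(xD i); rewrite subnK ?add0n // ltnW.
have xT : x #|T| = x 0%N.
  by have -> : #|T| = p by apply: anti_leq; rewrite p_le card_le.
have T_gt0 : (0 < #|T|)%N by apply/card_gt0P; exists (x 0%N).
move=> m m'; split=> [|eq_m]; last by rewrite (x_mod _ m xT) (x_mod _ m' xT) eq_m.
wlog le_mm' : m m' / (m <= m')%N.
  by move=> IH; case: (leqP m m') => [|/ltnW] le_m eq_x; [|symmetry]; apply: IH.
move=> eq_x; suff : (#|T| %| m' - m)%N.
  by rewrite -eqn_mod_dvd // => /eqP->.
have xt : x (m' - m)%N = x 0%N by apply/(xD m); rewrite subnK ?add0n.
rewrite /dvdn eqn0Ngt; apply/negP => r_gt0.
suff: (#|T| <= (m' - m) %% #|T|)%N by rewrite leqNgt ltn_pmod.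
by apply: card_le => //; rewrite -x_mod.
Qed.

Lemma cyclic_int_sequence (d : nat) (x : nat -> int) : (0 < d)%N ->
  (forall m m', (d %| x m - x m')%Z = (d %| x m.+1 - x m'.+1)%Z) ->
  (forall c, exists m, (d %| x m - c)%Z) ->
  forall m m', (d %| x m - x m')%Z = (m == m' %[mod d]).
Proof.
move=> d_gt0 xS xsurj m m'.
have dZ : d%:Z != 0 by lia.
have lt_d z : (`|(z %% d)%Z|%N < d)%N.
  by have := modz_ge0 z dZ; have := ltz_pmod z (d := d); lia.
pose c z := Ordinal (lt_d z).
have cE y z : c y = c z <-> (d %| y - z)%Z.
  rewrite -eqz_mod_dvd; split=> [[]|/eqP eqyz]; last by apply/val_inj; rewrite /= eqyz.
  by have := modz_ge0 y dZ; have := modz_ge0 z dZ; move=> *; apply/eqP; lia.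
have cyc : c (x m) = c (x m') <-> m = m' %[mod d].
  have := @cyclic_sequence _ (c \o x); rewrite card_ord; apply=> [i j|z] /=.
    by rewrite !cE xS.
  have [i /cE ci] := xsurj (val z); exists i; rewrite ci; apply/val_inj => /=.
  by rewrite modz_small //; case: z {ci} => z ltz /=; lia.
by apply/idP/eqP => [/cE/cyc|/cyc/cE].
Qed.

(** Modulo n, the multiples of s are those of gcd(n, s). This eliminates the index l from
    [graph_rel], leaving a congruence between partial sums. *)
Lemma dvdz_gcdn_shift (n s : nat) (z : int) : (0 < n)%N ->
  (gcdn n s %| z)%Z <-> exists l : nat, (n %| l%:Z * s%:Z + z)%Z.
Proof.
move=> n_gt0; split=> [/dvdzP[q ->]|[l]]; last first.
  move/(dvdz_trans (_ : (gcdn n s %| n%:Z)%Z)) => /(_ (dvdn_gcdl n s)).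
  have ds : (gcdn n s %| l%:Z * s%:Z)%Z by apply/dvdz_mull/dvdn_gcdr.
  by move=> /rpredB/(_ ds); rewrite addrAC subrr add0r.
have [u [v]] := Bezoutz n%:Z s%:Z; rewrite /gcdz /= => defd.
(* With z = q d and d = u n + v s, the coefficient - q v of s may be negative; its residue modulo n
   is natural. *)
pose w := (- q * v); exists `|(w %% n)%Z|%N; rewrite gez0_abs ?modz_ge0 //; last by lia.
rewrite (_ : _ + _ = ((w %% n)%Z - w) * s%:Z + q * u * n%:Z).
  apply: rpredD; last exact: dvdz_mull.
  by apply: dvdz_mulr; rewrite -eqz_mod_dvd modz_mod.
by rewrite -defd /w; ring.
Qed.

(** * Partial sums *)

Lemma psumS u m : psum u m.+1 = psum u m + u m.
Proof. by rewrite /psum big_nat_recr. Qed.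

Lemma psum0 u : psum u 0 = 0.
Proof. by rewrite /psum big_geq. Qed.

Lemma psum_ge (u : nat -> int) m m' : (forall i, 1 <= u i) -> (m <= m')%N ->
  m'%:Z - m%:Z <= psum u m' - psum u m.
Proof.
move=> u_ge1 /subnK<-; elim: (m' - m)%N => [|t IHt]; first by rewrite add0n; lia.
by rewrite addSn psumS; have := u_ge1 (t + m)%N; lia.
Qed.

Lemma psum_le (u : nat -> int) c m : (forall i, u i <= c) ->
  psum u m <= c * m%:Z.
Proof.
move=> u_le; elim: m => [|m IHm]; first by rewrite psum0; lia.
by rewrite psumS; have := u_le m; lia.
Qed.

Lemma psum_period (u : nat -> int) d m t : (forall i, u (i + d)%N = u i) ->
  psum u (m + d * t) = psum u m + psum u d * t%:Z.
Proof.
move=> u_per; elim: t => [|t IHt]; first by rewrite muln0 addn0; lia.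
have per1 i : psum u (i + d) = psum u i + psum u d.
  elim: i => [|i IHi]; first by rewrite psum0 add0n add0r.
  by rewrite addSn !psumS IHi u_per; ring.
by rewrite mulnS addnCA addnC per1 IHt intS; ring.
Qed.

(* The points (l s + psum a m, m k - psum b l) modulo n form the graph of a
   partial injection. *)
Definition graph_rel (n s k : nat) (a b : nat -> int) : Prop :=
  forall l l' m m' : nat,
    (n %| (l%:Z - l'%:Z) * s%:Z + (psum a m - psum a m'))%Z =
    (n %| (m%:Z - m'%:Z) * k%:Z - (psum b l - psum b l'))%Z.

Lemma graph_rel_sym n s k a b : graph_rel n s k a b -> graph_rel n k s b a.
Proof.
move=> G l l' m m'.
have -> : (l%:Z - l'%:Z) * k%:Z + (psum b m - psum b m')
        = (l%:Z - l'%:Z) * k%:Z - (psum b m' - psum b m) by ring.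
by rewrite -G -(rpredN _ (_ + _)); congr (_ %| _)%Z; ring.
Qed.

Definition covers (d : nat) (u : nat -> int) : Prop :=
  forall c : int, exists m : nat, (d %| psum u m - c)%Z.

(** * From the graph relation to the jumper conditions on one sequence *)

Section HalfJumper.
Variables (n s k : nat) (a b : nat -> int).
Hypotheses (n_gt0 : (0 < n)%N) (le_sn : (s <= n)%N).
Hypothesis range_a : forall i, 1 <= a i < s%:Z.
Hypothesis G : graph_rel n s k a b.
Hypothesis cov : covers (gcdn n s) a.
Let d_gt0 : (0 < gcdn n s)%N. Proof. by rewrite gcdn_gt0 n_gt0. Qed.

Lemma graph_shift m m' l : (n %| l%:Z * s%:Z + (psum a m - psum a m'))%Z =
  (n %| l%:Z * s%:Z + (psum a m.+1 - psum a m'.+1))%Z.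
Proof.
have := G l 0 m.+1 m'.+1; have := G l 0 m m'; rewrite !subr0 => -> ->.
by congr (_ %| _)%Z; rewrite !intS; ring.
Qed.

(** The partial sums meet every class by [cov], and by [graph_shift] two of them agree modulo
    [gcdn n s] exactly when their successors do. *)
Lemma graph_residue m m' :
  (gcdn n s %| psum a m - psum a m')%Z = (m == m' %[mod gcdn n s]).
Proof.
apply: cyclic_int_sequence => //. move=> {}m {}m'.
have E := @dvdz_gcdn_shift n s _ n_gt0.
by apply/idP/idP => /E[l nl]; apply/E; exists l; move: nl; rewrite (graph_shift m m').
Qed.

(** Some l s aligns the points of index i + d_s and i modulo n, and by [graph_shift] their
    successors as well. Subtracting, n divides a difference of absolute value less than s <= n. *)
Lemma graph_period i : a (i + gcdn n s) = a i.
Proof.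
have /(dvdz_gcdn_shift _ _ n_gt0)[l nl] :
    (gcdn n s %| psum a (i + gcdn n s) - psum a i)%Z.
  by rewrite graph_residue modnDr.
have := nl; rewrite graph_shift => nl'; have := rpredB nl' nl.
rewrite !psumS => /dvdzP[q]; have := range_a i; have := range_a (i + gcdn n s).
move: (a i) (a _) => x y ranx rany eq_q.
have {}eq_q : y - x = q * n%:Z by rewrite -eq_q; ring.
have n_pos : 0 < n%:Z by lia.
have : q * n%:Z < 1 * n%:Z by lia.
have : -1 * n%:Z < q * n%:Z by lia.
rewrite !ltr_pM2r // => q_gt q_lt; move: eq_q.
have -> : q = 0 by lia.
by rewrite mul0r; lia.
Qed.

(** Write n = q d_s d_k. After d_s q up steps the height d_s q k is a multiple of n, so n divides
    the corresponding partial sum, which is q times the sum over a period. *)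
Lemma graph_dvd : (gcdn n s * gcdn n k %| n)%N ->
  ((gcdn n s * gcdn n k)%N %| psum a (gcdn n s))%Z.
Proof.
case/dvdnP => q defn.
have q_gt0 : (0 < q)%N by case: q defn n_gt0 => // ->.
have : (n %| psum a (gcdn n s * q))%Z.
  have := G 0 0 (gcdn n s * q) 0; rewrite !psum0 subrr mul0r add0r !subr0 => ->.
  have /dvdnP[k' defk] := dvdn_gcdr n k.
  have E : (gcdn n s * q * k = k' * n)%N.
    by move: (gcdn n s) (gcdn n k) defk defn => x y -> ->; ring.
  by apply/dvdzP; exists k'%:Z; rewrite -!PoszM E.
rewrite -[X in psum a X]add0n psum_period; last exact: graph_period.
rewrite psum0 add0r [X in (Posz X %| _)%Z -> _]defn mulnC PoszM.
by rewrite dvdz_mul2r //; lia.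
Qed.

End HalfJumper.

Lemma psum_shift (u : nat -> int) d l l' (w : int) :
  (forall i, u (i + d)%N = u i) -> l%:Z - l'%:Z = d%:Z * w ->
  psum u l - psum u l' = w * psum u d.
Proof.
move=> u_per; case: (leP 0 w) => w0 eq_w.
  rewrite (_ : l = (l' + d * `|w|)%N); last by lia.
  by rewrite psum_period // gez0_abs //; ring.
rewrite (_ : l' = (l + d * `|w|)%N); last by lia.
by rewrite psum_period // ltz0_abs //; ring.
Qed.

(** * Symmetry, residues and the product condition *)

Lemma jumper_sym n s k a b : is_jumper s k n a b -> is_jumper k s n b a.
Proof.
case=> pa pb ra rb db vb da va prod; split=> //; rewrite 1?mulnC //.
by rewrite mulrC prod mulnC [(k * s)%N]mulnC.
Qed.

Lemma jumper_residue n s k a b m m' : (0 < n)%N -> is_jumper s k n a b ->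
  (gcdn n s %| psum a m - psum a m')%Z = (m == m' %[mod gcdn n s]).
Proof.
move=> n_gt0 J.
have dvd_ds : (gcdn n s %| psum a (gcdn n s))%Z.
  by have := jumper_dvd_a J; apply: dvdz_trans; rewrite PoszM dvdz_mulr.
have d_gt0 : (0 < gcdn n s)%N by rewrite gcdn_gt0 n_gt0.
have red_mod i : (psum a i = psum a (i %% gcdn n s)%N %[mod gcdn n s])%Z.
  apply/eqP; rewrite eqz_mod_dvd (@psum_shift _ (gcdn n s) _ _ (i %/ gcdn n s)%N).
  - exact: dvdz_mull.
  - exact: (jumper_period_a J).
  - by rewrite {1}(divn_eq i (gcdn n s)); lia.
rewrite -eqz_mod_dvd (red_mod m) (red_mod m').
apply/eqP/eqP => [|-> //].
by apply: (jumper_distinct_a J); rewrite ltn_pmod.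
Qed.

(** With sigma_a = al d_s d_k and sigma_b = be d_s d_k, the claim is n = s k + d_s d_k al be. The
    right-hand side is shown to be a multiple of n strictly between 0 and 2 n. *)
Lemma graph_prod (n s k : nat) (a b : nat -> int) :
  (0 < s)%N -> (0 < k)%N -> (s * k < n)%N ->
  (forall i, 1 <= a i < s%:Z) -> (forall i, 1 <= b i < k%:Z) ->
  (forall i, b (i + gcdn n k)%N = b i) ->
  ((gcdn n s * gcdn n k)%N %| psum a (gcdn n s))%Z ->
  ((gcdn n s * gcdn n k)%N %| psum b (gcdn n k))%Z ->
  graph_rel n s k a b ->
  psum a (gcdn n s) * psum b (gcdn n k)
    = (gcdn n s * gcdn n k)%N%:Z * (n%:Z - (s * k)%N%:Z).
Proof.
move=> s_gt0 k_gt0 lt_n range_a range_b per_b /dvdzP[al defa] /dvdzP[be defb] G.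
have n_gt0 : (0 < n)%N by lia.
have [S defs] := dvdnP (dvdn_gcdr n s).
have ds_gt0 : (0 < gcdn n s)%N by rewrite gcdn_gt0 n_gt0.
have dk_gt0 : (0 < gcdn n k)%N by rewrite gcdn_gt0 n_gt0.
have a_ge : 0 <= psum a (gcdn n s).
  have a1 i : 1 <= a i by case/andP: (range_a i).
  by have := psum_ge a1 (leq0n (gcdn n s)); rewrite psum0; lia.
have b_ge : 0 <= psum b (gcdn n k).
  have b1 i : 1 <= b i by case/andP: (range_b i).
  by have := psum_ge b1 (leq0n (gcdn n k)); rewrite psum0; lia.
have a_le : psum a (gcdn n s) <= (s%:Z - 1) * (gcdn n s)%:Z.
  by apply: psum_le => i; have := range_a i; lia.
have b_le : psum b (gcdn n k) <= (k%:Z - 1) * (gcdn n k)%:Z.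
  by apply: psum_le => i; have := range_b i; lia.
have [c c_inv] : exists c : nat, (n %| c%:Z * s%:Z + (- (gcdn n s)%:Z))%Z.
  by apply/(@dvdz_gcdn_shift n s _ n_gt0); exact: rpredNr (dvdzz _).
move: (gcdn n s) (gcdn n k) defs ds_gt0 dk_gt0 a_ge b_ge a_le b_le per_b defa defb c_inv.
move=> ds dk defs ds_gt0 dk_gt0 a_ge b_ge a_le b_le per_b defa defb c_inv.
have dd_gt0 : 0 < ds%:Z * dk%:Z by rewrite -PoszM ltz_nat muln_gt0 ds_gt0.
have al_ge : 0 <= al by move: a_ge; rewrite defa pmulr_lge0 // PoszM.
have be_ge : 0 <= be by move: b_ge; rewrite defb pmulr_lge0 // PoszM.
have dvd_n : (n %| s%:Z * k%:Z + ds%:Z * dk%:Z * al * be)%Z.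
  have : (n %| ds%:Z * k%:Z + psum b dk * (c%:Z * al))%Z.
    (* These indices make the horizontal difference d_k al (c s - d_s), a multiple of n by the
       choice of c. *)
    have := G (dk * (c * `|al|))%N 0%N 0%N ds.
    have -> : psum b (dk * (c * `|al|))%N = psum b dk * (c%:Z * al).
      by rewrite -[(dk * _)%N]add0n psum_period // psum0 add0r PoszM gez0_abs.
    rewrite !psum0 !subr0 sub0r sub0r.
    have -> : - ds%:Z * k%:Z - psum b dk * (c%:Z * al)
            = - (ds%:Z * k%:Z + psum b dk * (c%:Z * al)) by ring.
    rewrite [RHS]rpredN => <-; rewrite defa !PoszM gez0_abs //.
    have -> : dk%:Z * (c%:Z * al) * s%:Z - al * (ds%:Z * dk%:Z)
            = dk%:Z * al * (c%:Z * s%:Z - ds%:Z) by ring.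
    exact: dvdz_mull.
  (* Multiplying by S = s / d_s turns d_s k into s k; in the other term c S d_s = c s is then
     replaced by d_s modulo n. *)
  rewrite defb !PoszM => /(dvdz_mull S%:Z) dvd1.
  have dvd2 : (n %| dk%:Z * be * al * (c%:Z * s%:Z - ds%:Z))%Z by apply: dvdz_mull.
  have := rpredB dvd1 dvd2; rewrite defs PoszM.
  by rewrite [X in X \in _](_ : _ = S%:Z * ds%:Z * k%:Z + ds%:Z * dk%:Z * al * be); last by ring.
suff -> : n%:Z - (s * k)%N%:Z = ds%:Z * dk%:Z * al * be.
  by rewrite defa defb !PoszM; ring.
(* The ranges give sigma_a sigma_b <= d_s d_k (s - 1) (k - 1), and (s - 1) (k - 1) < n. *)
have lt_r : ds%:Z * dk%:Z * al * be < n%:Z.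
  rewrite -(ltr_pM2l dd_gt0).
  have -> : ds%:Z * dk%:Z * (ds%:Z * dk%:Z * al * be) = psum a ds * psum b dk.
    by rewrite defa defb !PoszM; ring.
  apply: le_lt_trans (ler_pM a_ge b_ge a_le b_le) _.
  rewrite mulrACA [ltLHS]mulrC ltr_pM2l //.
  have -> : (s%:Z - 1) * (k%:Z - 1) = (s * k)%N%:Z - s%:Z - k%:Z + 1 by rewrite PoszM; ring.
  by lia.
have r_ge : 0 <= ds%:Z * dk%:Z * al * be by rewrite !mulr_ge0.
case/dvdzP: dvd_n => q; rewrite -PoszM.
move: (s * k)%N (_ * be) lt_r r_ge lt_n (muln_gt0 s k) => sk r' lt_r r_ge lt_n.
rewrite s_gt0 k_gt0 /= => sk_gt0 eq_q.
have n_pos : 0 < n%:Z by lia.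
have : 0 * n%:Z < q * n%:Z by lia.
have : q * n%:Z < 2 * n%:Z by lia.
rewrite !ltr_pM2r // => q_lt q_gt; move: eq_q.
have -> : q = 1 by lia.
by rewrite mul1r; lia.
Qed.

(** * From a jumper to the graph relation *)

Section JumperGraph.
Variables (n s k : nat) (a b : nat -> int).
Hypothesis n_gt0 : (0 < n)%N.
Hypothesis dvd_n : (gcdn n s * gcdn n k %| n)%N.
Hypothesis J : is_jumper s k n a b.

Lemma jumper_covers : covers (gcdn n s) a.
Proof.
move=> c; have d_gt0 : (0 < gcdn n s)%N by rewrite gcdn_gt0 n_gt0.
have dZ : (gcdn n s)%:Z != 0 by lia.
have lt_d z : (`|(z %% gcdn n s)%Z|%N < gcdn n s)%N.
  by have := modz_ge0 z dZ; have := ltz_pmod z (d := gcdn n s); lia.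
pose f (i : 'I_(gcdn n s)) := Ordinal (lt_d (psum a i)).
have f_inj : injective f.
  move=> i j [] /eqP; rewrite -eqz_nat !gez0_abs ?modz_ge0 // eqz_mod_dvd.
  by rewrite (jumper_residue _ _ n_gt0 J) !modn_small // => /eqP/val_inj.
have /mapP[i _ /(congr1 val) /= /eqP] := (injF_onto f_inj (Ordinal (lt_d c))).
rewrite -eqz_nat !gez0_abs ?modz_ge0 // eq_sym eqz_mod_dvd.
by exists (val i).
Qed.

(** Modulo d_s the hypothesis gives m - m' = d_s t, and then modulo d_s d_k it gives l - l' = d_k w.
    Both differences of partial sums become multiples of the sums over a period, and n = s k + d_s
    d_k al be turns one congruence into the other. *)
Lemma jumper_graph_impl (l l' m m' : nat) :
  (n %| (l%:Z - l'%:Z) * s%:Z + (psum a m - psum a m'))%Z ->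
  (n %| (m%:Z - m'%:Z) * k%:Z - (psum b l - psum b l'))%Z.
Proof.
move=> dvd_x; have d_gt0 : (0 < gcdn n s)%N by rewrite gcdn_gt0 n_gt0.
have dk_gt0 : (0 < gcdn n k)%N by rewrite gcdn_gt0 n_gt0.
have [S defs] := dvdnP (dvdn_gcdr n s).
have [N defn] := dvdnP (dvdn_gcdl n s).
have /dvdzP[t eq_t] : (gcdn n s %| m%:Z - m'%:Z)%Z.
  rewrite -eqz_mod_dvd !modz_nat eqz_nat -(jumper_residue _ _ n_gt0 J).
  have ds_x : (gcdn n s %| (l%:Z - l'%:Z) * s%:Z + (psum a m - psum a m'))%Z.
    by apply: dvdz_trans dvd_x; apply: dvdn_gcdl.
  have ds_l : (gcdn n s %| (l%:Z - l'%:Z) * s%:Z)%Z by apply/dvdz_mull/dvdn_gcdr.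
  by have := rpredB ds_x ds_l; rewrite addrAC subrr add0r.
have eq_a : psum a m - psum a m' = t * psum a (gcdn n s).
  by apply: psum_shift; [exact: jumper_period_a J | rewrite eq_t mulrC].
have /dvdzP[al defa] := jumper_dvd_a J.
have /dvdzP[be defb] := jumper_dvd_b J.
have prod := jumper_prod J.
have cNS : coprimez N S.
  by rewrite [coprimez _ _]eqz_nat -(eqn_pmul2r d_gt0) mul1n muln_gcdl -defs -defn.
(* This is where d_s d_k dividing n enters; it makes d_k coprime to S. *)
have dkN : (gcdn n k %| N)%N.
  by rewrite -(dvdn_pmul2l d_gt0) [(_ * N)%N]mulnC -defn.
have /dvdzP[w eq_w] : (gcdn n k %| l%:Z - l'%:Z)%Z.
  have : (gcdn n k %| (l%:Z - l'%:Z) * S%:Z)%Z.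
    have dd_x := @dvdz_trans n%:Z (gcdn n s * gcdn n k)%N%:Z _ dvd_n dvd_x.
    have dd_a : (gcdn n s * gcdn n k %| psum a m - psum a m')%Z.
      by rewrite eq_a; apply/dvdz_mull/(jumper_dvd_a J).
    have := rpredB dd_x dd_a; rewrite addrK.
    have -> : (l%:Z - l'%:Z) * s%:Z = (l%:Z - l'%:Z) * S%:Z * (gcdn n s)%:Z.
      by rewrite -mulrA -PoszM -defs.
    by rewrite mulnC PoszM dvdz_mul2r //; lia.
  rewrite Gauss_dvdzl //; apply: coprimez_dvdl dkN cNS.
have eq_b : psum b l - psum b l' = w * psum b (gcdn n k).
  by apply: psum_shift; [exact: jumper_period_b J | rewrite eq_w mulrC].
rewrite eq_b eq_t; case/dvdzP: dvd_x => q; rewrite eq_w eq_a defa => eq_q.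
rewrite defb; move: defs defn prod cNS eq_q n_gt0 d_gt0 dk_gt0; rewrite defa defb.
move: (gcdn n s) (gcdn n k) => ds dk defs defn prod cNS eq_q n_pos ds_gt0 dk_gt0.
have dd_neq0 : ds%:Z * dk%:Z != 0 by rewrite mulf_neq0 //; lia.
have {}prod : ds%:Z * dk%:Z * al * be = n%:Z - s%:Z * k%:Z.
  by apply: (mulfI dd_neq0); move: prod; rewrite !PoszM => <-; ring.
(* The factor S lets s k and w d_k s appear, which [prod] and [eq_q] eliminate; being coprime to N,
   it is cancelled afterwards. *)
have : (N %| S%:Z * (t * k%:Z - w * dk%:Z * be))%Z.
  have ds_neq0 : ds%:Z != 0 by lia.
  apply/dvdzP; exists (t - be * q); apply: (mulfI ds_neq0).
  have eqN : ds%:Z * N%:Z = n%:Z by rewrite defn PoszM mulrC.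
  have eqS : ds%:Z * S%:Z = s%:Z by rewrite defs PoszM mulrC.
  rewrite mulrA eqS [RHS]mulrCA eqN mulrBl -[be * q * _]mulrA -eq_q.
  have -> : n%:Z = ds%:Z * dk%:Z * al * be + s%:Z * k%:Z by rewrite prod subrK.
  by rewrite PoszM; ring.
rewrite Gauss_dvdzr // => /dvdzP[p eq_p]; apply/dvdzP; exists p.
by rewrite defn !PoszM [RHS]mulrA -eq_p; ring.
Qed.
End JumperGraph.

Lemma jumper_graph n s k a b : (0 < n)%N ->
  (gcdn n s * gcdn n k %| n)%N -> is_jumper s k n a b -> graph_rel n s k a b.
Proof.
move=> n_gt0 dvd_n J l l' m m'; apply/idP/idP => dvd_x.
  exact: (jumper_graph_impl n_gt0 dvd_n J).
rewrite -rpredN opprD -mulNr opprB.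
apply: (jumper_graph_impl n_gt0 _ (jumper_sym J)); first by rewrite mulnC.
by rewrite -[X in _ + X]opprB.
Qed.

(** * Clash-freeness of the unreduced points in Z^2 *)

(** Partial sums increase. If l - l' and m - m' have the same sign, the two terms of the first
    expression reinforce each other; if the signs are opposite, those of the second do. A bound
    fails unless both differences vanish. *)
Lemma lattice_clash (s k : nat) (a b : nat -> int) (l l' m m' : nat) :
  (forall i, 1 <= a i) -> (forall i, 1 <= b i) ->
  `|(l%:Z - l'%:Z) * s%:Z + (psum a m - psum a m')| < s%:Z ->
  `|(m%:Z - m'%:Z) * k%:Z - (psum b l - psum b l')| < k%:Z ->
  l = l' /\ m = m'.
Proof.
move=> a_ge b_ge.
have mul_ge (c p q : nat) : (p < q)%N -> c%:Z <= (q%:Z - p%:Z) * c%:Z.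
  by move=> lt_pq; rewrite -[leLHS]mul1r ler_wpM2r //; lia.
wlog le_mm' : l l' m m' / (m' <= m)%N.
  move=> IH; case: (leqP m' m) => [|/ltnW le_m]; first exact: IH.
  have swap_x : (l%:Z - l'%:Z) * s%:Z + (psum a m - psum a m')
    = - ((l'%:Z - l%:Z) * s%:Z + (psum a m' - psum a m)) by ring.
  have swap_y : (m%:Z - m'%:Z) * k%:Z - (psum b l - psum b l')
    = - ((m'%:Z - m%:Z) * k%:Z - (psum b l' - psum b l)) by ring.
  by rewrite swap_x swap_y !normrN => x_lt y_lt; case: (IH l' l m' m).
have := psum_ge a_ge le_mm'.
case: (ltngtP l l') => [lt_l|lt_l|->].
- have := psum_ge b_ge (ltnW lt_l); have := mul_ge s _ _ lt_l.
  move: le_mm'; rewrite leq_eqVlt => /orP[/eqP->|/(mul_ge k)]; lia.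
- have := psum_ge b_ge (ltnW lt_l); have := mul_ge s _ _ lt_l; lia.
move: le_mm'; rewrite leq_eqVlt => /orP[/eqP->//|/(mul_ge k)]; lia.
Qed.

Lemma int_diff (z : int) : exists p q : nat, z = p%:Z - q%:Z.
Proof. by case: z => p; [exists p, 0%N | exists 0%N, p.+1]; lia. Qed.

(* With k = K dk and s = S ds, shifting the parameters (l, m) by (dk K, ds be)
   moves the corresponding point of Z^2 by (n, 0), and shifting them by
   (- dk al, ds S) moves it by (0, n).  These shifts may be negative, so each is
   split as a difference of two natural numbers, one for each point. *)
Lemma jumper_clash n s k a b (l l' m m' : nat) (u v : int) : (0 < n)%N ->
  is_jumper s k n a b ->
  `|u| < s%:Z -> `|v| < k%:Z ->
  (n %| (l%:Z - l'%:Z) * s%:Z + (psum a m - psum a m') - u)%Z ->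
  (n %| (m%:Z - m'%:Z) * k%:Z - (psum b l - psum b l') - v)%Z ->
  u = 0 /\ v = 0.
Proof.
move=> n_gt0 J u_lt v_lt /dvdzP[z1 eq_x] /dvdzP[z2 eq_y].
have a_ge i : 1 <= a i by case/andP: (jumper_range_a J i).
have b_ge i : 1 <= b i by case/andP: (jumper_range_b J i).
have := jumper_prod J; have := jumper_period_a J; have := jumper_period_b J.
have /dvdzP[al defa] := jumper_dvd_a J; have /dvdzP[be defb] := jumper_dvd_b J.
have [S defs] := dvdnP (dvdn_gcdr n s); have [K defk] := dvdnP (dvdn_gcdr n k).
have ds_gt0 : (0 < gcdn n s)%N by rewrite gcdn_gt0 n_gt0.
have dk_gt0 : (0 < gcdn n k)%N by rewrite gcdn_gt0 n_gt0.
move: (gcdn n s) (gcdn n k) ds_gt0 dk_gt0 defs defk defa defb.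
move=> ds dk ds_gt0 dk_gt0 defs defk defa defb per_b per_a prod.
have dd_neq0 : ds%:Z * dk%:Z != 0 by rewrite mulf_neq0 //; lia.
have defn : n%:Z = ds%:Z * dk%:Z * al * be + s%:Z * k%:Z.
  apply: (mulfI dd_neq0); move: prod; rewrite defa defb !PoszM => prod.
  by apply/eqP; rewrite mulrDr -subr_eq -mulrBr -prod; apply/eqP; ring.
(* Undoing the excess (z1 n, z2 n) takes z1 times the first translation and z2 times the second; w
   and t are the resulting coefficients of dk and ds. *)
have [w1 [w2 eq_w]] := int_diff (z1 * K%:Z - z2 * al).
have [t1 [t2 eq_t]] := int_diff (z2 * S%:Z + z1 * be).
have eq_s : s%:Z = S%:Z * ds%:Z by rewrite defs PoszM.
have eq_k : k%:Z = K%:Z * dk%:Z by rewrite defk PoszM.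
have eq_u : ((l + dk * w2)%N%:Z - (l' + dk * w1)%N%:Z) * s%:Z
            + (psum a (m + ds * t2) - psum a (m' + ds * t1)) = u.
  rewrite !psum_period // defa !PoszD !PoszM.
  transitivity ((l%:Z - l'%:Z) * s%:Z + (psum a m - psum a m')
     - dk%:Z * (w1%:Z - w2%:Z) * s%:Z - al * (ds%:Z * dk%:Z) * (t1%:Z - t2%:Z)).
    by ring.
  rewrite -eq_w -eq_t -[X in X - _ - _](subrK u) eq_x defn eq_s eq_k; ring.
have eq_v : ((m + ds * t2)%N%:Z - (m' + ds * t1)%N%:Z) * k%:Z
            - (psum b (l + dk * w2) - psum b (l' + dk * w1)) = v.
  rewrite !psum_period // defb !PoszD !PoszM.
  transitivity ((m%:Z - m'%:Z) * k%:Z - (psum b l - psum b l')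
     - ds%:Z * (t1%:Z - t2%:Z) * k%:Z + be * (ds%:Z * dk%:Z) * (w1%:Z - w2%:Z)).
    by ring.
  rewrite -eq_w -eq_t -[X in X - _ + _](subrK v) eq_y defn eq_s eq_k; ring.
have [] := @lattice_clash s k a b (l + dk * w2) (l' + dk * w1)
  (m + ds * t2) (m' + ds * t1) a_ge b_ge; rewrite ?eq_u ?eq_v //.
by move=> eq_l eq_m; rewrite -eq_u -eq_v eq_l eq_m; split; ring.
Qed.

Lemma pair_inj (T U : Type) (x x' : T) (y y' : U) :
  (x, y) = (x', y') -> x = x' /\ y = y'.
Proof. by case. Qed.

(** * Congruences and distances in Z_n *)

Section Zn.
Variable n : nat.
Hypothesis n_gt1 : (1 < n)%N.

Lemma intrZp_eq0 (z : int) : (z%:~R == 0 :> 'Z_n) = (n %| z)%Z.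
Proof.
have natE m : (m%:R == 0 :> 'Z_n) = (n %| m)%N by rewrite -val_eqE /= val_Zp_nat.
by case: z => m; rewrite ?NegzE ?rmorphN ?oppr_eq0 ?rpredN natE.
Qed.

Lemma eq_intrZp (x y : int) : (x%:~R == y%:~R :> 'Z_n) = (n %| x - y)%Z.
Proof. by rewrite -intrZp_eq0 rmorphB subr_eq0. Qed.

Lemma intrZp_small (z : int) : `|z| < n%:Z -> z%:~R = 0 :> 'Z_n -> z = 0.
Proof.
move=> z_lt /eqP; rewrite intrZp_eq0 dvdzE /=.
by case: z z_lt => [[|m]|m] //= z_lt /dvdn_leq; lia.
Qed.

Lemma intr_val (x : 'Z_n) : (nat_of_ord x)%:~R = x.
Proof. by rewrite -pmulrn natr_Zp. Qed.

Lemma cdist_ltP (d : nat) (i j : 'Z_n) :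
  (cdist i j < d)%N <-> exists2 u : int, `|u| < d%:Z & i = j + u%:~R.
Proof.
rewrite /cdist gtn_min; split=> [/orP[] lt_d|[u u_lt ->]].
- by exists (Posz (i - j)%R); rewrite // intr_val addrC subrK.
- exists (- Posz (j - i)%R); first by rewrite normrN.
  by rewrite rmorphN [X in - X]intr_val opprB addrC subrK.
apply/orP; case: u u_lt => m m_lt; [left|right].
  rewrite addrAC subrr add0r -pmulrn val_Zp_nat //.
  by apply: leq_ltn_trans (leq_mod _ _) _.
rewrite NegzE mulrNz opprB addrCA subrr addr0 -pmulrn val_Zp_nat //.
by apply: leq_ltn_trans (leq_mod _ _) _.
Qed.

(** * Clash-free and clockwise permutations in terms of steps *)

Section Steps.
Variables (s k : nat) (pi : {perm 'Z_n}).
Hypotheses (s_gt0 : (0 < s)%N) (k_gt0 : (0 < k)%N).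
Hypotheses (lt_sn : (s < n)%N) (lt_kn : (k < n)%N).

Definition far_apart : Prop := forall (i : 'Z_n) (u v : int),
  `|u| < s%:Z -> `|v| < k%:Z ->
  pi (i + u%:~R) = pi i + v%:~R -> u = 0 /\ v = 0.

(** The displacement in the top-edge clause of [clockwise_rect]; [touching_above] recovers the
    touching from [far_apart]. The bottom-edge clause is the same relation seen from the upper
    rectangle. *)
Definition up_step : Prop := forall i : 'Z_n,
  exists2 a : nat, (1 <= a < s)%N & pi (i + a%:R) = pi i + k%:R.

Definition right_step : Prop := forall i : 'Z_n,
  exists2 b : nat, (1 <= b < k)%N & pi (i + s%:R) = pi i - b%:R.

Lemma clash_freeP : clash_free s k pi <-> far_apart.
Proof.
split=> [cf i u v u_lt v_lt eq_pi|far i j neq_ij /cdist_ltP[u u_lt eq_i]].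
  have u0 : u%:~R = 0 :> 'Z_n.
    apply/eqP/negPn/negP => u_neq0.
    have neq_i : i + u%:~R != i by rewrite -subr_eq0 addrAC subrr add0r.
    have /(cf _ _ neq_i) : (cdist (i + u%:~R)%R i < s)%N by apply/cdist_ltP; exists u.
    by rewrite leqNgt => /negP[]; apply/cdist_ltP; exists v.
  split; apply: intrZp_small => //; [lia|lia|].
  by apply: (@addrI _ (pi i)); rewrite -eq_pi u0 !addr0.
rewrite leqNgt; apply/negP => /cdist_ltP[v v_lt]; rewrite eq_i => eq_pi.
have [u0 _] := far _ _ _ u_lt v_lt eq_pi.
by rewrite eq_i u0 addr0 eqxx in neq_ij.
Qed.

Lemma touchP (j : 'Z_n) (E : {set 'Z_n * 'Z_n}) :
  ~~ [disjoint rect s k pi j & E] <->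
  exists x y, [/\ (x < s)%N, (y < k)%N & (j + x%:R, pi j + y%:R) \in E].
Proof.
rewrite -setI_eq0; split=> [/set0Pn[p /setIP[/imset2P[x y _ _ ->] xyE]]|].
  by exists x, y.
move=> [x [y [ltx lty xyE]]]; apply/set0Pn; eexists; apply/setIP; split; last exact: xyE.
by apply/imset2P; exists (Ordinal ltx) (Ordinal lty).
Qed.

Hypothesis far : far_apart.

Lemma far_eq (i j : 'Z_n) (u v : int) : `|u| < s%:Z -> `|v| < k%:Z ->
  j - i = u%:~R -> pi j - pi i = v%:~R -> u = 0 /\ v = 0.
Proof.
move=> u_lt v_lt eq_u eq_v; apply: (far (i := i)) => //.
by rewrite -eq_u -eq_v addrC subrK addrC subrK.
Qed.

(** A rectangle meeting these cells in its bottom row has the height of R_j, so it is R_j by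
    injectivity of [pi]. In a higher row y its vertical offset k - y from R_i lies strictly between
    0 and k, against [far_apart]. The other edges are similar. *)
Lemma touching_above (i j : 'Z_n) (a : nat) : (a < s)%N ->
  j = i + a%:R -> pi j = pi i + k%:R ->
  the_rect_touching s k pi (cells_above s k pi i) j.
Proof.
move=> a_lt eq_j eq_pij j'; split=> [/touchP[x [y [ltx lty /imsetP[x0 _ eq_p]]]]|->].
  have {eq_p} [eq_x eq_y] := pair_inj eq_p.
  case: y lty eq_y => [_|y lty] eq_y.
    by apply: (@perm_inj _ pi); rewrite eq_pij -eq_y addr0.
  have [] := @far_eq i j' (x0%:Z - x%:Z) (k%:Z - y.+1%:Z); try lia.
  - by have := ltn_ord x0; lia.
  - by rewrite rmorphB /= -!pmulrn -[j'](addrK x%:R) eq_x; ring.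
  - by rewrite rmorphB /= -!pmulrn -[pi j'](addrK y.+1%:R) eq_y; ring.
apply/touchP; exists 0, 0; split=> //; rewrite !addr0 eq_pij eq_j.
by apply/imsetP; exists (Ordinal a_lt).
Qed.

Lemma touching_right (i j : 'Z_n) (b : nat) : (b < k)%N ->
  j = i + s%:R -> pi j = pi i - b%:R ->
  the_rect_touching s k pi (cells_right s k pi i) j.
Proof.
move=> b_lt eq_j eq_pij j'; split=> [/touchP[x [y [ltx lty /imsetP[y0 _ eq_p]]]]|->].
  have {eq_p} [eq_x eq_y] := pair_inj eq_p.
  case: x ltx eq_x => [_|x ltx] eq_x; first by rewrite eq_j -eq_x addr0.
  have [] := @far_eq i j' (s%:Z - x.+1%:Z) (y0%:Z - y%:Z); try lia.
  - by have := ltn_ord y0; lia.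
  - by rewrite rmorphB /= -!pmulrn -[j'](addrK x.+1%:R) eq_x; ring.
  - by rewrite rmorphB /= -!pmulrn -[pi j'](addrK y%:R) eq_y; ring.
apply/touchP; exists 0, b; split=> //; rewrite addr0 eq_pij eq_j subrK.
by apply/imsetP; exists (Ordinal k_gt0); rewrite ?addr0.
Qed.

Lemma touching_below (i j : 'Z_n) (a : nat) : (a < s)%N ->
  j = i - a%:R -> pi j = pi i - k%:R ->
  the_rect_touching s k pi (cells_below s pi i) j.
Proof.
move=> a_lt eq_j eq_pij j'; split=> [/touchP[x [y [ltx lty /imsetP[x0 _ eq_p]]]]|->].
  have {eq_p} [eq_x eq_y] := pair_inj eq_p.
  have [eq_k|neq_k] := eqVneq y.+1 k.
    apply: (@perm_inj _ pi); rewrite eq_pij -eq_k -[pi j'](addrK y%:R) eq_y; ring.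
  have [] := @far_eq i j' (x0%:Z - x%:Z) (- y.+1%:Z); try lia.
  - by have := ltn_ord x0; lia.
  - by rewrite rmorphB /= -!pmulrn -[j'](addrK x%:R) eq_x; ring.
  - by rewrite rmorphN /= -!pmulrn -[pi j'](addrK y%:R) eq_y; ring.
apply/touchP; exists a, k.-1; split=> //; first by rewrite prednK.
apply/imsetP; exists (Ordinal s_gt0) => //=; rewrite addr0 eq_pij eq_j subrK.
by rewrite -{1}(prednK k_gt0); congr (_, _); ring.
Qed.

Lemma touching_left (i j : 'Z_n) (b : nat) : (b < k)%N ->
  j = i - s%:R -> pi j = pi i + b%:R ->
  the_rect_touching s k pi (cells_left k pi i) j.
Proof.
move=> b_lt eq_j eq_pij j'; split=> [/touchP[x [y [ltx lty /imsetP[y0 _ eq_p]]]]|->].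
  have {eq_p} [eq_x eq_y] := pair_inj eq_p.
  have [eq_s|neq_s] := eqVneq x.+1 s.
    by rewrite eq_j -eq_s -[j'](addrK x%:R) eq_x; ring.
  have [] := @far_eq i j' (- x.+1%:Z) (y0%:Z - y%:Z); try lia.
  - by have := ltn_ord y0; lia.
  - by rewrite rmorphN /= -!pmulrn -[j'](addrK x%:R) eq_x; ring.
  - by rewrite rmorphB /= -!pmulrn -[pi j'](addrK y%:R) eq_y; ring.
apply/touchP; exists s.-1, 0; split=> //; first by rewrite prednK.
apply/imsetP; exists (Ordinal b_lt) => //=; rewrite addr0 eq_pij eq_j.
by rewrite -{1}(prednK s_gt0); congr (_, _); ring.
Qed.

Lemma clockwiseP : clockwise s k pi <-> up_step /\ right_step.
Proof.
split=> [cw|[up right] i].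
  split=> i; have [[j _ [a a_lt [eq_j eq_pi]]] [j' _ [b b_lt [eq_j' eq_pi']]] _ _] := cw i.
    by exists a; rewrite // -eq_j.
  by exists b; rewrite // -eq_j'.
split.
- have [a a_lt eq_pi] := up i; exists (i + a%:R); last by exists a.
  by case/andP: (a_lt) => _ lt; apply: (touching_above lt).
- have [b b_lt eq_pi] := right i; exists (i + s%:R); last by exists b.
  by case/andP: (b_lt) => _ lt; apply: (touching_right lt).
(* The rectangle at height pi i - k steps up to height pi i, hence to i. *)
- have [a a_lt] := up ((pi^-1)%g (pi i - k%:R)); rewrite permKV subrK => /perm_inj eq_i.
  have eq_j : (pi^-1)%g (pi i - k%:R) = i - a%:R by rewrite -[in RHS]eq_i addrK.
  have eq_pi : pi (i - a%:R) = pi i - k%:R by rewrite -eq_j permKV.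
  exists (i - a%:R); last by exists a.
  by case/andP: (a_lt) => _ lt; apply: (touching_below lt).
- have [b b_lt] := right (i - s%:R); rewrite subrK => eq_i.
  have eq_pi : pi (i - s%:R) = pi i + b%:R by rewrite eq_i subrK.
  exists (i - s%:R); last by exists b.
  by case/andP: (b_lt) => _ lt; apply: (touching_left lt).
Qed.
End Steps.
End Zn.

(** * The staircases of a clockwise permutation *)

(** Up steps raise the height by exactly k, so the m-th rectangle above the origin is the preimage
    of m k. The representative in [0, n) serves as the integer displacement. *)
Definition up_gap (n k : nat) (pi : {perm 'Z_n}) (m : nat) : int :=
  nat_of_ord ((pi^-1)%g (m.+1 * k)%:R - (pi^-1)%g (m * k)%:R)%R.

Definition right_gap (n s : nat) (pi : {perm 'Z_n}) (l : nat) : int :=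
  nat_of_ord (pi (l * s)%:R - pi (l.+1 * s)%:R)%R.

Section Orbit.
Variables (n s k : nat) (pi : {perm 'Z_n}).
Hypotheses (n_gt1 : (1 < n)%N) (s_gt0 : (0 < s)%N) (k_gt0 : (0 < k)%N).
Hypotheses (lt_sn : (s < n)%N) (lt_kn : (k < n)%N).
Hypotheses (far : far_apart s k pi) (up : up_step s k pi).
Hypotheses (right : right_step s k pi) (pi0 : pi 0 = 0).

Let A (i : 'Z_n) : nat := ((pi^-1)%g (pi i + k%:R) - i)%R.
Let B (i : 'Z_n) : nat := (pi i - pi (i + s%:R))%R.

Let A_gap i : (1 <= A i < s)%N /\ pi (i + (A i)%:R) = pi i + k%:R.
Proof.
have [a a_lt eq_pi] := up i.
suff -> : A i = a by [].
by rewrite /A -eq_pi permK addrAC subrr add0r val_Zp_nat // modn_small //; lia.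
Qed.

Let B_gap i : (1 <= B i < k)%N /\ pi (i + s%:R) = pi i - (B i)%:R.
Proof.
have [b b_lt eq_pi] := right i.
suff -> : B i = b by [].
by rewrite /B eq_pi opprB addrC subrK val_Zp_nat // modn_small //; lia.
Qed.

(* The points reached from [i] by going up then right, and right then up, are
   too close to be distinct. *)
Let gap_commute i : A (i + s%:R) = A i /\ B (i + (A i)%:R) = B i.
Proof.
have [A1 eqA1] := A_gap i; have [A2 eqA2] := A_gap (i + s%:R).
have [B1 eqB1] := B_gap i; have [B2 eqB2] := B_gap (i + (A i)%:R).
set u : int := (A (i + s%:R))%:Z - (A i)%:Z.
set v : int := (B (i + (A i)%:R))%:Z - (B i)%:Z.
suff : u = 0 /\ v = 0 by rewrite /u /v; lia.
apply: (far (i := i + (A i)%:R + s%:R)); [rewrite /u; lia | rewrite /v; lia |].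
have -> : i + (A i)%:R + s%:R + u%:~R = i + s%:R + (A (i + s%:R))%:R.
  by rewrite /u rmorphB /= -!pmulrn; ring.
by rewrite eqA2 eqB1 eqB2 eqA1 /v rmorphB /= -!pmulrn; ring.
Qed.

Let a := up_gap k pi.
Let b := right_gap s pi.

Let A_shift i l : A (i + (l * s)%:R) = A i.
Proof.
elim: l => [|l IHl]; first by rewrite mul0n addr0.
by rewrite mulSn addnC natrD addrA (gap_commute _).1.
Qed.

(** Kept conditional because the induction proving [pi_up] uses it. *)
Let a_A m : pi (psum a m)%:~R = (m * k)%:R -> a m = A (psum a m)%:~R.
Proof.
by move=> eq_pi; rewrite /A eq_pi -natrD addnC -mulSn -[(psum a m)%:~R](permK pi) eq_pi.
Qed.

Let pi_up m : pi (psum a m)%:~R = (m * k)%:R.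
Proof.
elim: m => [|m IHm]; first by rewrite psum0 mul0n pi0.
rewrite psumS rmorphD /= (a_A IHm) -[X in _ + X]pmulrn (A_gap _).2 IHm.
by rewrite -natrD addnC -mulSn.
Qed.

Lemma gap_range_a m : 1 <= a m < s%:Z.
Proof. by rewrite (a_A (pi_up m)); have [] := A_gap (psum a m)%:~R; lia. Qed.

Lemma gap_range_b l : 1 <= b l < k%:Z.
Proof.
have -> : b l = B (l * s)%:R by rewrite /b /right_gap /B mulSn addnC natrD.
by have [] := B_gap (l * s)%:R; lia.
Qed.

(** By [gap_commute], climbing does not change the drop to the right ([BE]), so the right step from
    the point of parameters l and m is b l for every m. The induction on l starts from [pi_up]. *)
Lemma gap_param l m :
  pi ((l * s)%:R + (psum a m)%:~R) = (m * k)%:R - (psum b l)%:~R.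
Proof.
have BE m' l' : B ((l' * s)%:R + (psum a m')%:~R) = b l' :> int.
  elim: m' => [|m' IHm'].
    by rewrite psum0 addr0 /b /right_gap /B [in RHS]mulSn addnC natrD.
  have A_eq : A ((l' * s)%:R + (psum a m')%:~R) = A (psum a m')%:~R.
    by rewrite addrC A_shift.
  rewrite -IHm' -[in RHS](gap_commute (_ + _)).2 A_eq psumS rmorphD /= (a_A (pi_up m')).
  by rewrite -pmulrn -addrA.
elim: l => [|l IHl]; first by rewrite mul0n add0r pi_up psum0 subr0.
rewrite mulSn addnC natrD addrAC (B_gap _).2 IHl psumS rmorphD /= -(BE m) -pmulrn.
by rewrite opprD addrA.
Qed.

(** The orbit is closed under up and left steps. They lead towards i from an orbit point less than s
    to its left, unless i sits in a hole, which [far_apart] excludes. *)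
Lemma orbit_full (i : 'Z_n) : exists l m, i = (l * s)%:R + (psum a m)%:~R.
Proof.
pose O (i : 'Z_n) := exists l m, i = (l * s)%:R + (psum a m)%:~R.
have O_left j : O j -> O (j - s%:R).
  (* Modulo n, subtracting s amounts to adding (n - 1) s. *)
  move=> [l [m ->]]; exists (l + n.-1)%N, m.
  have : (n * s)%:R = 0 :> 'Z_n by rewrite natrM pchar_Zp // mul0r.
  have e : ((l + n.-1) * s + s = l * s + n * s)%N.
    by rewrite -mulSnr -addnS prednK ?mulnDl // ltnW.
  move=> ns0; apply: (@addIr _ s%:R).
  by rewrite subrK [RHS]addrAC -[in RHS]natrD e natrD ns0 addr0.
have O_up j : O j -> O (j + (A j)%:R).
  move=> [l [m ->]]; exists l, m.+1.
  have -> : A ((l * s)%:R + (psum a m)%:~R) = A (psum a m)%:~R by rewrite addrC A_shift.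
  by rewrite psumS (a_A (pi_up m)) rmorphD /= -pmulrn addrA.
(* An up step, followed by a left step if the horizontal offset became
   negative, lowers the vertical offset until it is smaller than k in absolute
   value; both offsets then vanish. *)
have near N p (u v : nat) : (v <= N)%N -> (u < s)%N -> O p ->
    pi (p + u%:R) = pi p + v%:R -> O (p + u%:R).
  elim: N p u v => [|N IHN] p u v v_le u_lt Op eq_pi; have [v_lt|v_ge] := ltnP v k.
  - have [] := far (i := p) (u := u) (v := v); [lia|lia|by rewrite -!pmulrn|].
    by move=> [->] _; rewrite addr0.
  - by lia.
  - have [] := far (i := p) (u := u) (v := v); [lia|lia|by rewrite -!pmulrn|].
    by move=> [->] _; rewrite addr0.
  have [A1 eqA] := A_gap p; have [A_le|A_gt] := leqP (A p) u.
    have e : p + u%:R = p + (A p)%:R + (u - A p)%:R by rewrite natrB //; ring.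
    rewrite e; apply: IHN (v - k)%N _ _ (O_up _ Op) _; [lia | lia |].
    by rewrite -e eq_pi eqA natrB //; ring.
  have [] := B_gap (p + (A p)%:R - s%:R); rewrite subrK eqA.
  move: (O_left _ (O_up _ Op)); set p2 := p + _ - _ => O_p2.
  move: (B p2) => B2 B_rg eqB.
  (* The new horizontal offset lies strictly between 0 and s, since u < A p < s. *)
  have eq_p : p + u%:R = p2 + (s + u - A p)%N%:R.
    by rewrite natrB ?natrD; [rewrite /p2; ring | lia].
  have [B_le|B_gt] := leqP (k + B2) v.
    rewrite eq_p; apply: IHN (v - (k + B2))%N _ _ O_p2 _; [lia | lia |].
    rewrite -eq_p eq_pi natrB // natrD -[pi p2](subrK B2%:R) -eqB; ring.
  (* The hole: k <= v < k + B2 and B2 < k put the vertical offset from p2 strictly between -k and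
     0. *)
  have [] := far (i := p2) (u := (s + u - A p)%N) (v := v%:Z - k%:Z - B2%:Z);
    [lia | lia | | lia].
  rewrite -pmulrn -eq_p eq_pi !rmorphB /= -!pmulrn -[pi p2](subrK B2%:R) -eqB; ring.
pose q : 'Z_n := (i %/ s * s)%:R.
have O_q : O q by exists (i %/ s)%N, 0%N; rewrite psum0 addr0.
have -> : i = q + (i %% s)%:R by rewrite /q -natrD -divn_eq natr_Zp.
apply: near (leqnn (pi (q + (i %% s)%:R) - pi q)%R) _ O_q _; first by rewrite ltn_pmod.
by rewrite [in RHS]natr_Zp [RHS]addrC subrK.
Qed.
End Orbit.

(** * From a permutation to a jumper *)

Lemma point_intr n (l s m : nat) (x : int) :
  (l * s)%:R + x%:~R = (l%:Z * s%:Z + x)%:~R :> 'Z_n.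
Proof. by rewrite rmorphD /= -PoszM -pmulrn. Qed.

Lemma eq_points n s (a : nat -> int) l l' m m' : (1 < n)%N ->
  ((l * s)%:R + (psum a m)%:~R == (l' * s)%:R + (psum a m')%:~R :> 'Z_n)
  = (n %| (l%:Z - l'%:Z) * s%:Z + (psum a m - psum a m'))%Z.
Proof.
by move=> n_gt1; rewrite !point_intr // eq_intrZp //; congr (_ %| _)%Z; ring.
Qed.

Lemma eq_values n k (b : nat -> int) l l' m m' : (1 < n)%N ->
  ((m * k)%:R - (psum b l)%:~R == (m' * k)%:R - (psum b l')%:~R :> 'Z_n)
  = (n %| (m%:Z - m'%:Z) * k%:Z - (psum b l - psum b l'))%Z.
Proof.
move=> n_gt1; rewrite -!rmorphN /= !point_intr // eq_intrZp //.
by congr (_ %| _)%Z; ring.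
Qed.

Section GapJumper.
Variables (n s k : nat) (pi : {perm 'Z_n}).
Hypotheses (n_gt1 : (1 < n)%N) (s_gt0 : (0 < s)%N) (k_gt0 : (0 < k)%N).
Hypotheses (lt_sn : (s < n)%N) (lt_kn : (k < n)%N).
Hypotheses (far : far_apart s k pi) (up : up_step s k pi).
Hypotheses (right : right_step s k pi) (pi0 : pi 0 = 0).
Hypotheses (lt_skn : (s * k < n)%N) (dvd_n : (gcdn n s * gcdn n k %| n)%N).

Let a := up_gap k pi.
Let b := right_gap s pi.
Let param l m :
  pi ((l * s)%:R + (psum a m)%:~R) = (m * k)%:R - (psum b l)%:~R.
Proof. exact: gap_param. Qed.
Let full (i : 'Z_n) : exists l m, i = (l * s)%:R + (psum a m)%:~R.
Proof. exact: orbit_full. Qed.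

Lemma gap_graph : graph_rel n s k a b.
Proof.
by move=> l l' m m'; rewrite -eq_points // -eq_values // -!param (inj_eq perm_inj).
Qed.

Lemma gap_covers_a : covers (gcdn n s) a.
Proof.
move=> c; have [l [m /esym/eqP]] := full c%:~R.
rewrite point_intr // eq_intrZp // => dvd_x; exists m.
apply/(@dvdz_gcdn_shift n s _ (ltnW n_gt1)); exists l.
by rewrite addrA.
Qed.

(** At the point of value - c the term m k vanishes modulo d_k, leaving the partial sum of b
    congruent to c. *)
Lemma gap_covers_b : covers (gcdn n k) b.
Proof.
move=> c; have [l [m /(congr1 pi)/eqP]] := full ((pi^-1)%g (- c)%:~R).
rewrite permKV param -rmorphN point_intr // eq_intrZp // => dvd_x; exists l.
have dk_x := @dvdz_trans n%:Z (gcdn n k)%:Z _ (dvdn_gcdl n k) dvd_x.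
have dk_m : (gcdn n k %| m%:Z * k%:Z)%Z by apply/dvdz_mull/dvdn_gcdr.
by move: (rpredD dk_x dk_m) => h; apply: etrans h; congr (_ %| _)%Z; ring.
Qed.

Lemma gap_jumper : is_jumper s k n a b.
Proof.
have n_gt0 := ltnW n_gt1; have G := gap_graph; have Gs := graph_rel_sym G.
have range_a i : 1 <= a i < s%:Z by apply: gap_range_a.
have range_b i : 1 <= b i < k%:Z by apply: gap_range_b.
have dvd_a := graph_dvd n_gt0 (ltnW lt_sn) range_a G gap_covers_a dvd_n.
have dvd_b : ((gcdn n s * gcdn n k)%N %| psum b (gcdn n k))%Z.
  rewrite mulnC; apply: (graph_dvd n_gt0 (ltnW lt_kn) range_b Gs gap_covers_b).
  by rewrite mulnC.
have per_b := graph_period n_gt0 (ltnW lt_kn) range_b Gs gap_covers_b.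
split=> //.
- exact: (graph_period n_gt0 (ltnW lt_sn) range_a G gap_covers_a).
- move=> l l' ltl ltl' /eqP; rewrite eqz_mod_dvd.
  by rewrite (graph_residue n_gt0 Gs gap_covers_b) !modn_small // => /eqP.
- move=> l l' ltl ltl' /eqP; rewrite eqz_mod_dvd.
  by rewrite (graph_residue n_gt0 G gap_covers_a) !modn_small // => /eqP.
exact: graph_prod.
Qed.
End GapJumper.

(** * From a jumper to a permutation *)

Section JumperPerm.
Variables (n s k : nat) (a b : nat -> int).
Hypotheses (n_gt1 : (1 < n)%N) (s_gt0 : (0 < s)%N) (k_gt0 : (0 < k)%N).
Hypotheses (lt_sn : (s < n)%N) (lt_kn : (k < n)%N).
Hypotheses (dvd_n : (gcdn n s * gcdn n k %| n)%N) (J : is_jumper s k n a b).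

Lemma jumper_full (i : 'Z_n) :
  exists lm : nat * nat, (lm.1 * s)%:R + (psum a lm.2)%:~R = i.
Proof.
have n_gt0 := ltnW n_gt1.
have [m] := jumper_covers n_gt0 dvd_n J (nat_of_ord i).
move/(@dvdz_gcdn_shift n s _ n_gt0) => [l dvd_l]; exists (l, m).
apply/eqP; rewrite -[eqbRHS]intr_val point_intr // eq_intrZp //.
by rewrite -addrA.
Qed.

(** Parameters are chosen for each i; [graph_rel] makes the value independent of the choice and the
    resulting map injective. *)
Lemma jumper_perm : exists pi : {perm 'Z_n}, forall l m,
  pi ((l * s)%:R + (psum a m)%:~R) = (m * k)%:R - (psum b l)%:~R.
Proof.
have [f fE] := choice jumper_full.
have G := jumper_graph (ltnW n_gt1) dvd_n J.
pose g i : 'Z_n := ((f i).2 * k)%:R - (psum b (f i).1)%:~R.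
have g_inj : injective g.
  by move=> i j /eqP; rewrite eq_values // -G -eq_points // !fE => /eqP.
exists (perm g_inj) => l m; rewrite permE; apply/eqP.
by rewrite eq_values // -G -eq_points // fE.
Qed.

Variable pi : {perm 'Z_n}.
Hypothesis piE : forall l m,
  pi ((l * s)%:R + (psum a m)%:~R) = (m * k)%:R - (psum b l)%:~R.

Lemma jumper_pi0 : pi 0 = 0.
Proof. by have := piE 0 0; rewrite !psum0 !mul0n addr0 subr0. Qed.

Lemma jumper_far : far_apart s k pi.
Proof.
move=> i u v u_lt v_lt; have [[l' m'] /= <-] := jumper_full i.
have [[l m] /= eq_p] := jumper_full ((l' * s)%:R + (psum a m')%:~R + u%:~R).
rewrite -eq_p !piE => eq_v.
apply: (jumper_clash (l := l) (l' := l') (m := m) (m' := m') _ J) => //; first exact: ltnW.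
  move/eqP: eq_p; rewrite !point_intr // -rmorphD eq_intrZp //.
  by move=> h; apply: etrans h; congr (_ %| _)%Z; ring.
move/eqP: eq_v; rewrite -!rmorphN /= !point_intr // -rmorphD eq_intrZp //.
by move=> h; apply: etrans h; congr (_ %| _)%Z; ring.
Qed.

Let absa m : ((`|a m|%N)%:R : 'Z_n) = (a m)%:~R /\ (1 <= `|a m|%N < s)%N.
Proof. by have := jumper_range_a J m; rewrite pmulrn; case: (a m) => //= p; lia. Qed.

Let absb l : ((`|b l|%N)%:R : 'Z_n) = (b l)%:~R /\ (1 <= `|b l|%N < k)%N.
Proof. by have := jumper_range_b J l; rewrite pmulrn; case: (b l) => //= p; lia. Qed.

Lemma jumper_up : up_step s k pi.
Proof.
move=> i; have [[l m] /= <-] := jumper_full i; have [abs_eq abs_rg] := absa m.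
exists `|a m|%N => //; rewrite abs_eq -addrA -rmorphD -psumS !piE mulSn natrD; ring.
Qed.

Lemma jumper_right : right_step s k pi.
Proof.
move=> i; have [[l m] /= <-] := jumper_full i; have [abs_eq abs_rg] := absb l.
exists `|b l|%N => //; rewrite abs_eq.
have -> : (l * s)%:R + (psum a m)%:~R + s%:R = (l.+1 * s)%:R + (psum a m)%:~R :> 'Z_n.
  by rewrite mulSn natrD; ring.
by rewrite !piE psumS rmorphD /= opprD addrA.
Qed.

Lemma jumper_up_gap : up_gap k pi = a.
Proof.
apply/funext => m; have [abs_eq abs_rg] := absa m.
have piV m' : (pi^-1)%g (m' * k)%:R = (psum a m')%:~R.
  by apply: (@perm_inj _ pi); rewrite permKV -[(psum a m')%:~R]add0r (piE 0) psum0 subr0.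
have diff : (psum a m.+1)%:~R - (psum a m)%:~R = (`|a m|%N)%:R :> 'Z_n.
  by rewrite psumS rmorphD /= addrAC subrr add0r abs_eq.
rewrite /up_gap !piV diff val_Zp_nat //.
by rewrite modn_small; have := jumper_range_a J m; lia.
Qed.

Lemma jumper_right_gap : right_gap s pi = b.
Proof.
apply/funext => l; have [abs_eq abs_rg] := absb l.
have pi_s l' : pi (l' * s)%:R = - (psum b l')%:~R.
  by have := piE l' 0; rewrite psum0 addr0 mul0n sub0r.
have diff : - (psum b l)%:~R - - (psum b l.+1)%:~R = (`|b l|%N)%:R :> 'Z_n.
  by rewrite psumS rmorphD /= opprK addKr abs_eq.
rewrite /right_gap !pi_s diff val_Zp_nat //.
by rewrite modn_small; have := jumper_range_b J l; lia.
Qed.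
End JumperPerm.

End Auxiliary.

Theorem theorem11 (n k s r : nat)
  (hk : 0 < k) (hkn : k < n)
  (hs : s = (n - 1) %/ k)
  (hn : n = s * k + r) (hr : 1 <= r <= k)
  (hrk : r < k) (hrs : r < s)
  (hd : gcdn n s * gcdn n k %| n) :
  exists f : {perm 'Z_n} -> (nat -> int) * (nat -> int),
    set_bij (clockwise_perms n s k) (jumpers s k n) f.
Proof.
have s_gt0 : 0 < s by lia.
have n_gt1 : 1 < n by lia.
have lt_skn : s * k < n by lia.
have lt_sn : s < n by nia.
have cwP pi : clockwise_perms n s k pi <->
    [/\ far_apart s k pi, up_step s k pi, right_step s k pi & pi 0%R = 0%R].
  split=> [[/(clash_freeP n_gt1 _ s_gt0 hk lt_sn hkn) far cw pi0]|[far up right pi0]].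
    by have /(_ cw)[] := (clockwiseP n_gt1 s_gt0 hk lt_sn hkn far).1.
  split=> //; first exact/(clash_freeP n_gt1 _ s_gt0 hk lt_sn hkn).
  exact/(clockwiseP n_gt1 s_gt0 hk lt_sn hkn far).
exists (fun pi => (up_gap k pi, right_gap s pi)); split.
- by move=> pi /cwP[far up right pi0]; apply: gap_jumper.
- move=> pi pi' /set_mem/cwP[far up right pi0] /set_mem/cwP[far' up' right' pi0'].
  (* Equal gaps give the same parametrised graph, which reaches every i by [orbit_full]. *)
  case=> eq_up eq_right; apply/permP => i.
  have [l [m ->]] := orbit_full n_gt1 s_gt0 hk lt_sn hkn far up right pi0 i.
  by rewrite gap_param // eq_up eq_right gap_param.
move=> [a b] J; have {}J : is_jumper s k n a b := J.
have [pi piE] := jumper_perm n_gt1 hd J.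
have eq_up : up_gap k pi = a by apply: jumper_up_gap J _ piE.
have eq_right : right_gap s pi = b by apply: jumper_right_gap J _ piE.
exists pi; last by rewrite eq_up eq_right.
apply/cwP; split.
- exact: jumper_far J _ piE.
- exact: jumper_up J _ piE.
- exact: jumper_right J _ piE.
exact: jumper_pi0 piE.
Qed.
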